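(* For every integer $n>1$ the following hold. (a) $$\sum_{m=1}^{n-1}\sigma'_{1,11}(m,n-m) = \frac{5223960 n^{13} -20638800 n}{495331200}\psi_{-1}(n) + \frac{n^{11}}{24}\psi_{1}(n) - \frac{691 n}{65520} \psi_{11}(n).$$ (b) $$\sum_{m=1}^{n-1}\sigma'_{3,9}(m,n-m) = \frac{n^{13}}{2640} \psi_{-1}(n) - \frac{n^9}{240} \psi_{3}(n) + \frac{n^3}{264} \psi_{9}(n).$$ (c) $$\sum_{m=1}^{n-1}\sigma'_{5,7}(m,n-m) = \frac{n^{13}}{10080}\psi_{-1}(n) + \frac{n^7}{504}\psi_{5}(n) - \frac{n^5}{480} \psi_{7}(n).$$
   Context: $\mathbb{N}$ denotes the set of positive integers and $\mathbb{N}_0=\mathbb{N}\cup\{0\}$. For $m,n\in\mathbb{N}$ and $r,s\in\mathbb{N}_0$, $$\sigma'_{r,s}(m,n)=\sum_{\substack{(d,e)\in\mathbb{N}^2\\ d\mid m,\ e\mid n\\ \gcd(d,e)=\gcd(m/d,\,n/e)=1}} d^r e^s.$$ For $n\in\mathbb{N}$ and $s\in\mathbb{Z}\setminus\{0\}$, $\psi_s(n)=\sum_{d\mid n}\mu(d)d^s$, where the sum is over positive divisors $d$ of $n$ and $\mu$ is the Möbius function. *)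

(* Defs.v *)
From HB Require Import structures.
From mathcomp Require Import all_boot all_order all_algebra.
Set Implicit Arguments.
Unset Strict Implicit.
Unset Printing Implicit Defensive.
Import GRing.Theory.
Local Open Scope ring_scope.

(* Only the values at positive integers are meaningful; the junk value at 0
   is 1, since [primes 0] is empty. *)
Definition moebius (n : nat) : int :=
  if all (fun p => logn p n == 1%N) (primes n)
  then (-1) ^+ size (primes n) else 0.

(* [divisors 0] is empty, so the sum is 0 unless m and n are positive. *)
Definition sigma' (r s m n : nat) : nat :=
  (\sum_(d <- divisors m)
     \sum_(e <- divisors n | coprime d e && coprime (m %/ d) (n %/ e))
       d ^ r * e ^ s)%N.

(* The exponent s may be negative: psi takes rational values. *)
Definition psi (s : int) (n : nat) : rat :=
  \sum_(d <- divisors n) (moebius d)%:~R * d%:R ^ s.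

(* Main.v *)
Require Import Defs.
From mathcomp Require Import all_boot all_order all_algebra.
From mathcomp Require Import zify ring lra.
Import GRing.Theory Num.Theory.
Local Open Scope ring_scope.

(** Writing m = a x and n - m = b y, the left-hand sides are the sums of
    a^r b^s over the set Q(n) of quadruples (a, b, x, y) of positive integers
    with a x + b y = n and gcd(a, b) = gcd(x, y) = 1 ([sum_sigma']).

    The map (a, b, x, y) |-> (a, a + b, x - y, y) is a bijection from the part
    of Q(n) where y < x onto the part where a < b, and Q(n) is also stable
    under the exchange of (a, x) with (b, y).  Let g be a function with
    g(u, v) = g(v, u) = g(u, u - v).  Splitting the sum of g(a, b) according
    to the order of a and b, and the sum of g(a, a + b) according to the order
    of x and y, these two symmetries match the off-diagonal parts, and only the
    diagonals a = b = 1 and x = y = 1 survive ([qsum_invariant]):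

      sum over Q(n) of (g(a, b) - g(a, a + b))
        = sum over 0 < b < n with gcd(b, n) = 1 of (g(1, 1) - g(n, b)).

    The two symmetries of g generate a dihedral group of order 12, under which
    the invariant forms of degree 12 are the combinations of A^6, A^3 B^2 and
    B^4, where A = u^2 - u v + v^2 and B = u v (u - v) ([inv12]).  For
    such a form g(a, a + b) = g(a, -b), so the left-hand summand is twice the
    part of g(a, b) odd in b; each of a b^11 + a^11 b, a^3 b^9 + a^9 b^3 and
    a^5 b^7 + a^7 b^5 arises in this way from exactly one invariant form.

    On the right, Moebius inversion ([sum_coprime]) removes the coprimality
    condition and leaves, by homogeneity, the sums of g(m, j) over 1 <= j <= m
    for the divisors m of n.  For the three forms these are combinations of m^r,
    m^s and m^13 ([sum_inv12_1_11], [sum_inv12_3_9], [sum_inv12_5_7]), and the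
    terms m^i turn into n^i psi_(12 - i)(n) ([sum_psi]).  The constants g(1, 1)
    add up to g(1, 1) n psi_(-1)(n), which is nonzero only for the first form.
    The three parts are instances of [sum_sigma'_inv12]. *)

(** * Reindexing and Moebius inversion *)

(** Reindexing along mutually inverse maps between duplicate-free sequences. *)
Lemma sum_bij (I J : eqType) (V : nmodType) (s : seq I) (t : seq J)
    (f : I -> J) (g : J -> I) (F : J -> V) :
    uniq s -> uniq t ->
    (forall i, i \in s -> f i \in t /\ g (f i) = i) ->
    (forall j, j \in t -> g j \in s /\ f (g j) = j) ->
  \sum_(j <- t) F j = \sum_(i <- s) F (f i).
Proof.
move=> us ut fP gP; rewrite -(big_map f xpredT F); apply: perm_big.
apply: uniq_perm => //.
  rewrite map_inj_in_uniq // => i i' /fP[_ {2}<-] /fP[_ {2}<-] -> //.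
move=> j; apply/idP/mapP => [jt | [i /fP[? _] -> //]].
by have [gs fg] := gP j jt; exists (g j).
Qed.

Lemma moebius_mul_prime p e : prime p -> (0 < e)%N ->
  moebius (p * e) = if (p %| e)%N then 0 else - moebius e.
Proof.
move=> pr_p e_gt0; have p_gt0 := prime_gt0 pr_p.
have logp q : logn q (p * e) = ((p == q) + logn q e)%N.
  by rewrite lognM // logn_prime // eq_sym.
case: ifP => [p_e | p_ne].
  rewrite /moebius ifF //; apply/allP => /(_ p).
  rewrite mem_primes pr_p muln_gt0 p_gt0 e_gt0 dvdn_mulr // logp eqxx.
  have : (0 < logn p e)%N by rewrite logn_gt0 mem_primes pr_p e_gt0.
  by case: logn => // k _ /(_ isT).
have primes_pe : perm_eq (primes (p * e)) (p :: primes e).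
  apply: uniq_perm; rewrite ?primes_uniq //=.
    by rewrite primes_uniq andbT mem_primes p_ne !andbF.
  by move=> q; rewrite primesM // (primes_prime pr_p) !inE.
rewrite /moebius (perm_all _ primes_pe) (perm_size primes_pe) /= exprS mulN1r.
rewrite logp eqxx.
have -> : logn p e = 0%N.
  by apply/eqP; rewrite -leqn0 leqNgt logn_gt0 mem_primes p_ne !andbF.
rewrite addn0 eqxx /= (eq_in_all (a2 := fun q => logn q e == 1%N)).
  by case: ifP; rewrite ?oppr0.
move=> q q_e; rewrite logp; case: (eqVneq p q) => [pq | _]; last by [].
by move: q_e; rewrite -pq mem_primes p_ne !andbF.
Qed.

Lemma sum_moebius n : (0 < n)%N ->
  \sum_(d <- divisors n) moebius d = (n == 1%N)%:R.
Proof.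
move=> n_gt0; case: (eqVneq n 1%N) => [-> | n_neq1].
  by rewrite big_cons big_nil.
have n_gt1 : (1 < n)%N by rewrite ltn_neqAle eq_sym n_neq1.
have [p pr_p p_n] := pdivP n_gt1.
have p_gt0 := prime_gt0 pr_p.
(* The divisors of n that are multiples of p are the p e with e a divisor of
   n / p. Those with p | e contribute 0, and the others cancel the divisors of n
   that are prime to p. *)
have np_gt0 : (0 < n %/ p)%N by rewrite divn_gt0 ?(dvdn_leq n_gt0).
have -> : \sum_(d <- divisors n) moebius d
    = \sum_(d <- divisors n | ~~ (p %| d)%N) moebius d
      + \sum_(e <- divisors (n %/ p)) (if (p %| e)%N then 0 else - moebius e).
  rewrite (bigID (fun d => ~~ (p %| d)%N)) /=; congr (_ + _).
  rewrite (eq_bigl (fun d => (p %| d)%N)) => [|d]; last by rewrite negbK.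
  rewrite -big_filter.
  rewrite [LHS](@sum_bij _ _ _ (divisors (n %/ p)) _ (muln p) (divn^~ p)).
  - apply: eq_big_seq => e; rewrite -dvdn_divisors // => e_n.
    by rewrite moebius_mul_prime // (dvdn_gt0 _ e_n).
  - exact: divisors_uniq.
  - by rewrite filter_uniq ?divisors_uniq.
  - move=> e; rewrite mem_filter -!dvdn_divisors // => e_n.
    by rewrite dvdn_mulr // mulKn // mulnC -dvdn_divRL.
  - move=> d; rewrite mem_filter -!dvdn_divisors //.
    case/andP=> p_d d_n; split; last by rewrite mulnC divnK.
    by rewrite dvdn_divRL // divnK.
have -> : \sum_(e <- divisors (n %/ p)) (if (p %| e)%N then 0 else - moebius e)
    = \sum_(e <- divisors (n %/ p) | ~~ (p %| e)%N) - moebius e.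
  by rewrite [RHS]big_mkcond; apply: eq_bigr => e _; rewrite if_neg.
rewrite sumrN; apply/eqP; rewrite subr_eq0; apply/eqP.
rewrite -!(big_filter _ (fun d => ~~ (p %| d)%N)); apply: perm_big.
apply: uniq_perm; rewrite ?filter_uniq ?divisors_uniq // => d.
rewrite !mem_filter -!dvdn_divisors //.
case p_d: (p %| d)%N => //=; apply/idP/idP => [d_n | /dvdn_trans->//].
  rewrite dvdn_divRL // Gauss_dvd ?d_n //.
  by rewrite coprime_sym prime_coprime ?p_d.
by rewrite dvdn_divLR // dvdn_mulr.
Qed.

(** Moebius inversion: a sum over the b <= n coprime to n, in terms of the sums
    over all the multiples b <= n of each divisor of n. *)
Lemma sum_coprime (f : nat -> rat) n : (0 < n)%N ->
  \sum_(1 <= b < n.+1 | coprime n b) f b =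
  \sum_(d <- divisors n)
    (moebius d)%:~R * \sum_(1 <= j < (n %/ d).+1) f (d * j)%N.
Proof.
move=> n_gt0.
(* The indicator of gcd(n, b) = 1 is the sum of the Moebius function over the d
   dividing both n and b. *)
transitivity (\sum_(1 <= b < n.+1)
    \sum_(d <- divisors n | (d %| b)%N) (moebius d)%:~R * f b).
  rewrite big_mkcond; apply: eq_big_seq => b.
  rewrite mem_index_iota => /andP[b_gt0 _].
  have g_gt0 : (0 < gcdn n b)%N by rewrite gcdn_gt0 n_gt0.
  rewrite -mulr_suml -rmorph_sum /=.
  have -> : \sum_(d <- divisors n | (d %| b)%N) moebius d
            = \sum_(d <- divisors (gcdn n b)) moebius d.
    rewrite -big_filter; apply: perm_big; apply: uniq_perm;
      rewrite ?filter_uniq ?divisors_uniq // => d.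
    by rewrite mem_filter -!dvdn_divisors // dvdn_gcd andbC.
  by rewrite sum_moebius // /coprime; case: eqP; rewrite ?mul1r ?mul0r.
rewrite (exchange_big_dep xpredT) //=.
apply: eq_big_seq => d; rewrite -dvdn_divisors // => d_n.
have d_gt0 := dvdn_gt0 n_gt0 d_n.
rewrite -mulr_sumr; congr (_ * _); rewrite -[LHS]big_filter.
rewrite [LHS](@sum_bij _ _ _ (index_iota 1 (n %/ d).+1) _ (muln d) (divn^~ d)) //;
  rewrite ?filter_uniq ?iota_uniq // => b;
  rewrite !(mem_filter, mem_index_iota) !ltnS.
  case/andP=> b_gt0 b_le; rewrite mulKn // dvdn_mulr // muln_gt0 d_gt0 b_gt0.
  by rewrite mulnC -leq_divRL.
case/and3P=> d_b b_gt0 b_n; rewrite divn_gt0 // (dvdn_leq b_gt0) // leq_div2r //.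
by rewrite mulnC divnK.
Qed.

(** * Coprime representations n = a x + b y *)

(** The quadruples (a, b, x, y) of positive integers with a x + b y = n and
    gcd(a, b) = gcd(x, y) = 1, each listed once, in the order in which the
    double sum defining sigma' enumerates them (with m = a x). *)
Definition quads (n : nat) : seq (nat * nat * nat * nat) :=
  [seq (p.1, p.2, m %/ p.1, (n - m) %/ p.2)%N
     | m <- index_iota 1 n,
       p <- [seq (d, e) | d <- divisors m,
               e <- [seq e <- divisors (n - m)
                       | coprime d e && coprime (m %/ d) ((n - m) %/ e)]]].

Lemma mem_quads n a b x y :
  ((a, b, x, y) \in quads n) =
  [&& (0 < a)%N, (0 < b)%N, (0 < x)%N, (0 < y)%N,
      (a * x + b * y == n)%N, coprime a b & coprime x y].
Proof.
apply/allpairsPdep/idP.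
  case=> m [[d e]] []; rewrite mem_index_iota => /andP[m_gt0 m_n].
  have nm_gt0 : (0 < n - m)%N by rewrite subn_gt0.
  case/allpairsPdep=> d' [e' []]; rewrite mem_filter -!dvdn_divisors //.
  move=> d_m /andP[/andP[co_de co_xy] e_nm] [-> ->] /= [-> -> -> ->].
  rewrite co_de co_xy !divn_gt0 ?(dvdn_gt0 m_gt0 d_m) ?(dvdn_gt0 nm_gt0 e_nm) //.
  rewrite (dvdn_leq m_gt0 d_m) (dvdn_leq nm_gt0 e_nm) /=.
  by rewrite (mulnC d') (mulnC e') !divnK // subnKC ?eqxx ?(ltnW m_n).
case/and5P=> a_gt0 b_gt0 x_gt0 y_gt0 /and3P[/eqP n_eq co_ab co_xy].
have ax_gt0 : (0 < a * x)%N by rewrite muln_gt0 a_gt0.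
have by_gt0 : (0 < b * y)%N by rewrite muln_gt0 b_gt0.
have n_ax : (n - a * x = b * y)%N by rewrite -n_eq addKn.
exists (a * x)%N, (a, b); split; rewrite ?n_ax /= ?mulKn //.
  by rewrite mem_index_iota ax_gt0 -n_eq -[X in (X < _)%N]addn0 ltn_add2l.
apply/allpairsPdep; exists a, b; split=> //.
  by rewrite -dvdn_divisors // dvdn_mulr.
by rewrite mem_filter -dvdn_divisors // dvdn_mulr // !mulKn // co_ab co_xy.
Qed.

Lemma quads_uniq n : uniq (quads n).
Proof.
apply: allpairs_uniq_dep; first exact: iota_uniq.
  move=> m _; apply: allpairs_uniq_dep; first exact: divisors_uniq.
    by move=> d _; rewrite filter_uniq ?divisors_uniq.
  by move=> [d e] [d' e'] _ _ /= [-> ->].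
move=> [m [d e]] [m' [d' e']] /allpairsPdep[u [[v w] [um vw [-> -> ->]]]].
case/allpairsPdep=> [u' [[v' w'] [um' vw' [-> -> ->]]]] /= [eq1 eq2 eq3 eq4].
have dvd z v0 w0 (mz : z \in index_iota 1 n) : (v0, w0) \in
     [seq (d0, e0) | d0 <- divisors z,
               e0 <- [seq e0 <- divisors (n - z)
                       | coprime d0 e0 && coprime (z %/ d0) ((n - z) %/ e0)]] ->
     (v0 %| z)%N.
  move: mz; rewrite mem_index_iota => /andP[z_gt0 _].
  by case/allpairsPdep=> d0 [e0 [+ _ [-> _]]]; rewrite -dvdn_divisors.
have uu : u = u'.
  by rewrite -(divnK (dvd _ _ _ um vw)) -(divnK (dvd _ _ _ um' vw')) eq3 eq1.
by rewrite eq1 eq2 uu.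
Qed.

(** The sum of F(a, b) over the quadruples of [quads n] that satisfy P. *)
Definition qsum {V : zmodType} (n : nat) (P : nat -> nat -> nat -> nat -> bool)
    (F : nat -> nat -> V) : V :=
  \sum_(q <- quads n | let: (a, b, x, y) := q in P a b x y)
     let: (a, b, _, _) := q in F a b.

Lemma sum_sigma' (r s n : nat) :
  (\sum_(1 <= m < n) sigma' r s m (n - m))%N%:R
  = qsum n (fun _ _ _ _ => true) (fun a b => a%:R ^+ r * b%:R ^+ s : rat).
Proof.
rewrite /qsum [RHS](eq_bigl xpredT); last by case=> [[[a b] x] y].
rewrite big_allpairs_dep /= natr_sum; apply: eq_bigr => m _.
rewrite big_allpairs_dep /= natr_sum; apply: eq_bigr => d _.
by rewrite big_filter natr_sum; apply: eq_bigr => e _; rewrite natrM !natrX.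
Qed.

(** Exchange of (a, x) with (b, y). *)
Lemma qsum_swap {V : zmodType} (n : nat)
    (P : nat -> nat -> nat -> nat -> bool) (F : nat -> nat -> V) :
  qsum n P F = qsum n (fun a b x y => P b a y x) (fun a b => F b a).
Proof.
pose swap (q : nat * nat * nat * nat) := let: (a, b, x, y) := q in (b, a, y, x).
have swapP P0 q :
    q \in [seq q <- quads n | let: (a, b, x, y) := q in P0 a b x y] ->
    swap q \in [seq q <- quads n | let: (a, b, x, y) := q in P0 b a y x]
    /\ swap (swap q) = q.
  case: q => [[[a b] x] y]; rewrite /swap !mem_filter !mem_quads.
  rewrite addnC (coprime_sym b) (coprime_sym y).
  by case/and5P=> -> -> -> -> /and4P[-> -> -> ->].
rewrite /qsum -[LHS]big_filter -[RHS]big_filter.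
rewrite [LHS](@sum_bij _ _ _
   [seq q <- quads n | let: (a, b, x, y) := q in P b a y x] _ swap swap) ?filter_uniq ?quads_uniq //.
- by apply: eq_bigr => [[[[a b] x] y]].
- exact: (swapP (fun a b x y => P b a y x)).
- exact: swapP.
Qed.

(** The shear (a, b, x, y) |-> (a, a + b, x - y, y) preserves a x + b y and both
    coprimality conditions. *)
Lemma qsum_shear {V : zmodType} (n : nat) (F : nat -> nat -> V) :
  qsum n (fun a b _ _ => a < b)%N F
  = qsum n (fun _ _ x y => y < x)%N (fun a b => F a (a + b)%N).
Proof.
rewrite /qsum -[LHS]big_filter -[RHS]big_filter.
rewrite [LHS](@sum_bij _ _ _
   [seq q <- quads n | let: (a, b, x, y) := q in (y < x)%N] _
   (fun q => let: (a, b, x, y) := q in (a, a + b, x - y, y)%N)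
   (fun q => let: (a, b, x, y) := q in (a, b - a, x + y, y)%N))
   ?filter_uniq ?quads_uniq //.
- by apply: eq_bigr => [[[[a b] x] y]].
- move=> [[[a b] x] y]; rewrite !mem_filter !mem_quads.
  case/and5P=> lt_yx a_gt0 b_gt0 x_gt0 /and4P[y_gt0 /eqP n_eq co_ab co_xy].
  split; last by congr (_, _, _, _); lia.
  rewrite a_gt0 y_gt0 subn_gt0 lt_yx addn_gt0 a_gt0.
  rewrite -[X in (X < _)%N]addn0 ltn_add2l b_gt0.
  rewrite /coprime gcdnDl -/(coprime a b) co_ab.
  rewrite gcdnC -(gcdnDr y (x - y)) subnK ?(ltnW lt_yx) //.
  rewrite gcdnC -/(coprime x y) co_xy !andbT /=; apply/eqP.
  by rewrite -n_eq; nia.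
- move=> [[[a b] x] y]; rewrite !mem_filter !mem_quads.
  case/and5P=> lt_ab a_gt0 b_gt0 x_gt0 /and4P[y_gt0 /eqP n_eq co_ab co_xy].
  split; last by congr (_, _, _, _); lia.
  rewrite a_gt0 y_gt0 subn_gt0 lt_ab addn_gt0 x_gt0.
  rewrite -[X in (X < _)%N]add0n ltn_add2r x_gt0 /=.
  rewrite /coprime -(gcdnDl a (b - a)) subnKC ?(ltnW lt_ab) //.
  rewrite -/(coprime a b) co_ab gcdnC gcdnDr gcdnC -/(coprime x y) co_xy !andbT.
  by apply/eqP; rewrite -n_eq; nia.
Qed.

(** On the diagonals a = b and x = y, coprimality forces a = b = 1 and
    x = y = 1 respectively. *)
Lemma qsum_diagl {V : zmodType} (n : nat) (F : nat -> nat -> V) :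
  qsum n (fun a b _ _ => a == b) F = \sum_(1 <= x < n | coprime n x) F 1%N 1%N.
Proof.
rewrite /qsum -[LHS]big_filter -[RHS]big_filter.
rewrite [LHS](@sum_bij _ _ _ [seq x <- index_iota 1 n | coprime n x] _
   (fun x => (1, 1, x, n - x)%N) (fun q => q.1.2))
   ?filter_uniq ?iota_uniq ?quads_uniq //.
- move=> x; rewrite !mem_filter mem_index_iota mem_quads /=.
  case/and3P=> co_nx x_gt0 x_n.
  rewrite subn_gt0 x_gt0 x_n !mul1n subnKC ?(ltnW x_n) // eqxx /=; split=> //.
  by rewrite /coprime -(gcdnDr x (n - x)) subnK ?(ltnW x_n) // gcdnC.
- move=> [[[a b] x] y]; rewrite !mem_filter mem_index_iota mem_quads /=.
  case/and5P=> /eqP <- a_gt0 _ x_gt0 /and4P[y_gt0 n_eq].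
  rewrite /coprime gcdnn => /eqP a1; move: n_eq.
  rewrite a1 !mul1n => /eqP <- co_xy; rewrite gcdnC gcdnDl co_xy x_gt0.
  by rewrite -[X in (X < _)%N]addn0 ltn_add2l y_gt0 addKn.
Qed.

Lemma qsum_diagr {V : zmodType} (n : nat) (F : nat -> nat -> V) :
  qsum n (fun _ _ x y => x == y) F = \sum_(1 <= b < n | coprime n b) F (n - b)%N b.
Proof.
rewrite /qsum -[LHS]big_filter -[RHS]big_filter.
rewrite [LHS](@sum_bij _ _ _ [seq b <- index_iota 1 n | coprime n b] _
   (fun b => (n - b, b, 1, 1)%N) (fun q => q.1.1.2))
   ?filter_uniq ?iota_uniq ?quads_uniq //.
- move=> b; rewrite !mem_filter mem_index_iota mem_quads /=.
  case/and3P=> co_nb b_gt0 b_n.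
  rewrite subn_gt0 b_gt0 b_n !muln1 subnK ?(ltnW b_n) // eqxx /=; split=> //.
  by rewrite andbT /coprime gcdnC -(gcdnDr b (n - b)) subnK ?(ltnW b_n) // gcdnC.
- move=> [[[a b] x] y]; rewrite !mem_filter mem_index_iota mem_quads /=.
  case/and5P=> /eqP <- a_gt0 b_gt0 x_gt0 /and4P[y_gt0 n_eq co_ab].
  rewrite /coprime gcdnn => /eqP x1; move: n_eq; rewrite x1 !muln1 => /eqP <-.
  rewrite gcdnC gcdnDr gcdnC -/(coprime a b) co_ab b_gt0.
  by rewrite -[X in (X < _)%N]add0n ltn_add2r a_gt0 addnK.
Qed.

Lemma qsum_trichotomy {V : zmodType} (n : nat)
    (u v : nat -> nat -> nat -> nat -> nat) (F : nat -> nat -> V) :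
  qsum n (fun _ _ _ _ => true) F =
  qsum n (fun a b x y => u a b x y < v a b x y)%N F
  + qsum n (fun a b x y => v a b x y < u a b x y)%N F
  + qsum n (fun a b x y => u a b x y == v a b x y) F.
Proof.
rewrite /qsum [X in X + _ + _]big_mkcond [X in _ + X + _]big_mkcond.
rewrite [X in _ + _ + X]big_mkcond [LHS]big_mkcond -!big_split /=.
apply: eq_bigr => [[[[a b] x] y]] _.
by case: ltngtP; rewrite ?addr0 ?add0r.
Qed.

(** The hypotheses on g are those of the invariance g(u, v) = g(v, u) =
    g(u, u - v) that make sense on natural numbers. *)
Lemma qsum_invariant {V : zmodType} (n : nat) (g : nat -> nat -> V) :
    (forall a b, g a b = g b a) -> (forall a b, g a (a + b)%N = g b (a + b)%N) ->
  qsum n (fun _ _ _ _ => true) (fun a b => g a b - g a (a + b)%N)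
  = \sum_(1 <= b < n | coprime n b) (g 1%N 1%N - g n b).
Proof.
move=> g_sym g_shear.
have eqF P (F G : nat -> nat -> V) :
    (forall a b, F a b = G a b) -> qsum n P F = qsum n P G.
  by move=> FG; apply: eq_bigr => [[[[a b] x] y]] _.
have -> : qsum n (fun _ _ _ _ => true) (fun a b => g a b - g a (a + b)%N)
    = qsum n (fun _ _ _ _ => true) g
      - qsum n (fun _ _ _ _ => true) (fun a b => g a (a + b)%N).
  by rewrite /qsum -sumrB; apply: eq_bigr => [[[[a b] x] y]].
(* After the exchange of (a, x) and (b, y), the parts b < a and a < b of the
   first sum agree, as do the parts x < y and y < x of the second. *)
rewrite (qsum_trichotomy n (fun a _ _ _ => a) (fun _ b _ _ => b)).
rewrite [X in _ - X](qsum_trichotomy n (fun _ _ _ y => y) (fun _ _ x _ => x)).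
rewrite [qsum n (fun a b _ _ => b < a)%N _]qsum_swap.
rewrite (eqF _ (fun a b => g b a) g) // qsum_shear.
rewrite [qsum n (fun _ _ x y => x < y)%N _]qsum_swap.
rewrite (eqF _ (fun a b => g b (b + a)%N) (fun a b => g a (a + b)%N)); last first.
  by move=> a b; rewrite [in LHS]addnC -g_shear.
rewrite [qsum n (fun _ _ x y => y == x) _]qsum_swap qsum_diagl qsum_diagr.
rewrite opprD addrACA subrr add0r sumrB; congr (_ - _).
rewrite big_nat_cond [RHS]big_nat_cond; apply: eq_bigr => b /andP[/andP[_ b_n] _].
by rewrite subnKC ?(ltnW b_n) // g_sym.
Qed.

(** * Invariant forms of degree 12 *)

(** The general form of degree 12 in u, v over the rationals invariant under
    (u, v) |-> (v, u) and (u, v) |-> (u, u - v). Its value at (1, 1) is [al]. *)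
Definition inv12 (al be ga u v : rat) : rat :=
  al * (u ^+ 2 - u * v + v ^+ 2) ^+ 6
  + be * (u ^+ 2 - u * v + v ^+ 2) ^+ 3 * (u * v * (u - v)) ^+ 2
  + ga * (u * v * (u - v)) ^+ 4.

Lemma inv12_sym al be ga u v : inv12 al be ga u v = inv12 al be ga v u.
Proof. by rewrite /inv12; ring. Qed.

(** Combined with [inv12_sym], this is the invariance under
    (u, v) |-> (u, u - v), evaluated at (u + v, v). *)
Lemma inv12_shear al be ga u v :
  inv12 al be ga u (u + v) = inv12 al be ga v (u + v).
Proof. by rewrite /inv12; ring. Qed.

Lemma inv12_homog al be ga d u v :
  inv12 al be ga (d * u) (d * v) = d ^+ 12 * inv12 al be ga u v.
Proof. by rewrite /inv12; ring. Qed.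

Lemma sum_psi k i n : (0 < n)%N ->
  \sum_(d <- divisors n) (moebius d)%:~R * (d%:R ^+ k * (n %/ d)%:R ^+ i)
  = n%:R ^+ i * psi (k%:Z - i%:Z) n.
Proof.
move=> n_gt0; rewrite /psi mulr_sumr; apply: eq_big_seq => d.
rewrite -dvdn_divisors // => d_n; have d_gt0 := dvdn_gt0 n_gt0 d_n.
have d_neq0 : d%:R != 0 :> rat by rewrite pnatr_eq0 -lt0n.
have -> : (n %/ d)%:R = n%:R / d%:R :> rat.
  by apply: (mulIf d_neq0); rewrite -natrM divnK // divfK.
rewrite expfzDr // -exprnN exprMn exprVn -!exprnP; ring.
Qed.

Lemma sum_step (f S : nat -> rat) m :
  S 0%N = 0 -> (forall j, S j.+1 = S j + f j.+1) ->
  \sum_(1 <= j < m.+1) f j = S m.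
Proof.
move=> S0 SS; elim: m => [|m IHm]; first by rewrite big_nil S0.
by rewrite big_nat_recr //= IHm SS.
Qed.

(** If an invariant form has odd part (u^r v^s + u^s v^r) / 2 in v, and its row
    sums over 1 <= j <= m are combinations of m^r, m^s and m^13, then the sum of
    sigma'_(r,s) is a combination of values of psi.  The summand al n psi_(-1)(n)
    comes from the constant terms g(1, 1) in [qsum_invariant]. *)
Lemma sum_sigma'_inv12 (r s n : nat) (al be ga c1 c2 c3 : rat) : (1 < n)%N ->
    (forall u v, inv12 al be ga u v - inv12 al be ga u (u + v)
                 = u ^+ r * v ^+ s + u ^+ s * v ^+ r) ->
    (forall m : nat, \sum_(1 <= j < m.+1) inv12 al be ga m%:R j%:R
                     = c1 * m%:R ^+ r + c2 * m%:R ^+ s + c3 * m%:R ^+ 13) ->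
  2 * (\sum_(1 <= m < n) sigma' r s m (n - m))%N%:R
  = (al * n%:R - c3 * n%:R ^+ 13) * psi (-1) n
    - c1 * (n%:R ^+ r * psi (12 - r%:Z) n) - c2 * (n%:R ^+ s * psi (12 - s%:Z) n).
Proof.
move=> n_gt1 odd_part sum_row; have n_gt0 := ltnW n_gt1.
pose g (a b : nat) := inv12 al be ga a%:R b%:R.
have -> : 2 * (\sum_(1 <= m < n) sigma' r s m (n - m))%N%:R
    = qsum n (fun _ _ _ _ => true) (fun a b => g a b - g a (a + b)%N).
  have swap := qsum_swap n (fun _ _ _ _ => true)
    (fun a b => a%:R ^+ r * b%:R ^+ s : rat).
  rewrite sum_sigma' mulr2n mulrDl mul1r [X in _ + X]swap -big_split /=.
  apply: eq_bigr => [[[[a b] x] y]] _.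
  by rewrite /g natrD odd_part [X in _ + X]mulrC.
rewrite qsum_invariant => [|a b|a b]; last 2 first.
- exact: inv12_sym.
- by rewrite /g natrD inv12_shear.
(* The index n may be added, since n is not coprime to itself. *)
have -> : \sum_(1 <= b < n | coprime n b) (g 1%N 1%N - g n b)
    = \sum_(1 <= b < n.+1 | coprime n b) (g 1%N 1%N - g n b).
  rewrite [RHS]big_mkcond big_nat_recr // -big_mkcond /=.
  by rewrite /coprime gcdnn gtn_eqF // addr0.
rewrite sum_coprime //.
(* The constant term at the divisor d contributes n / d, written with exponents
   0 and 1 so that all the summands have the shape of [sum_psi]. *)
have row d : (d %| n)%N ->
    \sum_(1 <= j < (n %/ d).+1) (g 1%N 1%N - g n (d * j)%N)
    = al * (d%:R ^+ 0 * (n %/ d)%:R ^+ 1)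
      - c1 * (d%:R ^+ 12 * (n %/ d)%:R ^+ r) - c2 * (d%:R ^+ 12 * (n %/ d)%:R ^+ s)
      - c3 * (d%:R ^+ 12 * (n %/ d)%:R ^+ 13).
  move=> d_n; rewrite sumrB sumr_const_nat subn1 /=.
  have -> : g 1%N 1%N = al by rewrite /g /inv12; ring.
  rewrite (eq_bigr (fun j => d%:R ^+ 12 * inv12 al be ga (n %/ d)%:R j%:R)).
    by rewrite -mulr_sumr sum_row -mulr_natr; ring.
  by move=> j _; rewrite -inv12_homog -!natrM [(d * (n %/ d))%N]mulnC divnK.
rewrite (eq_big_seq (fun d =>
  al * ((moebius d)%:~R * (d%:R ^+ 0 * (n %/ d)%:R ^+ 1))
  - c1 * ((moebius d)%:~R * (d%:R ^+ 12 * (n %/ d)%:R ^+ r))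
  - c2 * ((moebius d)%:~R * (d%:R ^+ 12 * (n %/ d)%:R ^+ s))
  - c3 * ((moebius d)%:~R * (d%:R ^+ 12 * (n %/ d)%:R ^+ 13)))); last first.
  move=> d; rewrite -dvdn_divisors // => d_n; rewrite (row d d_n).
  by rewrite !mulrBr ![_%:~R * (_ * _)]mulrCA.
rewrite !sumrB -!mulr_sumr !sum_psi //.
by rewrite mulrBl expr1 !mulrA addrAC [in RHS]addrAC; ring.
Qed.

(** * Row sums of the three forms *)

(** In the three lemmas below the coefficients are those for which the part of
    the form odd in v is (u^r v^s + u^s v^r) / 2, where (r, s) is (1, 11), (3, 9)
    and (5, 7) respectively. *)
Lemma sum_inv12_1_11 (m : nat) :
  \sum_(1 <= j < m.+1) inv12 (- 1 / 12) (5 / 6) (- 47 / 24) m%:R j%:R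
  = 691 / 32760%N%:R * m%:R - 1 / 12 * m%:R ^+ 11
    - 691 / 32760%N%:R * m%:R ^+ 13.
Proof.
(* [T x y] is the sum of the form at (x, j) over 1 <= j <= y, obtained from the
   formulas for sums of powers; the row sum is its value at x = y = m. *)
pose T (x y : rat) : rat :=
  x ^+ 12 * (- 1 / 12 * y)
    + x ^+ 11 * (1 / 4 * y ^+ 2 + 1 / 4 * y)
    + x ^+ 10 * (- 11 / 36 * y ^+ 3 - 11 / 24 * y ^+ 2 - 11 / 72 * y)
    + x ^+ 8 * (11 / 40 * y ^+ 5 + 11 / 16 * y ^+ 4 + 11 / 24 * y ^+ 3
      - 11 / 240 * y)
    + x ^+ 6 * (- 11 / 42 * y ^+ 7 - 11 / 12 * y ^+ 6 - 11 / 12 * y ^+ 5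
      + 11 / 36 * y ^+ 3 - 11 / 252 * y)
    + x ^+ 4 * (11 / 72 * y ^+ 9 + 11 / 16 * y ^+ 8 + 11 / 12 * y ^+ 7
      - 77 / 120 * y ^+ 5 + 11 / 36 * y ^+ 3 - 11 / 240 * y)
    + x ^+ 2 * (- 1 / 12 * y ^+ 11 - 11 / 24 * y ^+ 10 - 55 / 72 * y ^+ 9
      + 11 / 12 * y ^+ 7 - 11 / 12 * y ^+ 5 + 11 / 24 * y ^+ 3 - 5 / 72 * y)
    + x * (1 / 24 * y ^+ 12 + 1 / 4 * y ^+ 11 + 11 / 24 * y ^+ 10
      - 11 / 16 * y ^+ 8 + 11 / 12 * y ^+ 6 - 11 / 16 * y ^+ 4
      + 5 / 24 * y ^+ 2)
    + (- 1 / 156 * y ^+ 13 - 1 / 24 * y ^+ 12 - 1 / 12 * y ^+ 11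
      + 11 / 72 * y ^+ 9 - 11 / 42 * y ^+ 7 + 11 / 40 * y ^+ 5
      - 5 / 36 * y ^+ 3 + 691 / 32760%N%:R * y).
rewrite (@sum_step _ (fun j => T m%:R j%:R)) => [||j].
- by rewrite /T; lra.
- by rewrite /T; lra.
- by rewrite /= -natr1 /T /inv12; lra.
Qed.

Lemma sum_inv12_3_9 (m : nat) :
  \sum_(1 <= j < m.+1) inv12 0 (- 1 / 10) (11 / 20) m%:R j%:R
  = - 1 / 132 * m%:R ^+ 3 + 1 / 120 * m%:R ^+ 9 - 1 / 1320 * m%:R ^+ 13.
Proof.
pose T (x y : rat) : rat :=
  x ^+ 10 * (- 1 / 30 * y ^+ 3 - 1 / 20 * y ^+ 2 - 1 / 60 * y)
    + x ^+ 9 * (1 / 8 * y ^+ 4 + 1 / 4 * y ^+ 3 + 1 / 8 * y ^+ 2)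
    + x ^+ 8 * (- 3 / 20 * y ^+ 5 - 3 / 8 * y ^+ 4 - 1 / 4 * y ^+ 3
      + 1 / 40 * y)
    + x ^+ 6 * (1 / 10 * y ^+ 7 + 7 / 20 * y ^+ 6 + 7 / 20 * y ^+ 5
      - 7 / 60 * y ^+ 3 + 1 / 60 * y)
    + x ^+ 4 * (- 1 / 12 * y ^+ 9 - 3 / 8 * y ^+ 8 - 1 / 2 * y ^+ 7
      + 7 / 20 * y ^+ 5 - 1 / 6 * y ^+ 3 + 1 / 40 * y)
    + x ^+ 3 * (1 / 20 * y ^+ 10 + 1 / 4 * y ^+ 9 + 3 / 8 * y ^+ 8
      - 7 / 20 * y ^+ 6 + 1 / 4 * y ^+ 4 - 3 / 40 * y ^+ 2)
    + x ^+ 2 * (- 1 / 110 * y ^+ 11 - 1 / 20 * y ^+ 10 - 1 / 12 * y ^+ 9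
      + 1 / 10 * y ^+ 7 - 1 / 10 * y ^+ 5 + 1 / 20 * y ^+ 3 - 1 / 132 * y).
rewrite (@sum_step _ (fun j => T m%:R j%:R)) => [||j].
- by rewrite /T; lra.
- by rewrite /T; lra.
- by rewrite /= -natr1 /T /inv12; lra.
Qed.

Lemma sum_inv12_5_7 (m : nat) :
  \sum_(1 <= j < m.+1) inv12 0 0 (- 1 / 8) m%:R j%:R
  = 1 / 240 * m%:R ^+ 5 - 1 / 252 * m%:R ^+ 7 - 1 / 5040%N%:R * m%:R ^+ 13.
Proof.
pose T (x y : rat) : rat :=
  x ^+ 8 * (- 1 / 40 * y ^+ 5 - 1 / 16 * y ^+ 4 - 1 / 24 * y ^+ 3
      + 1 / 240 * y)
    + x ^+ 7 * (1 / 12 * y ^+ 6 + 1 / 4 * y ^+ 5 + 5 / 24 * y ^+ 4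
      - 1 / 24 * y ^+ 2)
    + x ^+ 6 * (- 3 / 28 * y ^+ 7 - 3 / 8 * y ^+ 6 - 3 / 8 * y ^+ 5
      + 1 / 8 * y ^+ 3 - 1 / 56 * y)
    + x ^+ 5 * (1 / 16 * y ^+ 8 + 1 / 4 * y ^+ 7 + 7 / 24 * y ^+ 6
      - 7 / 48 * y ^+ 4 + 1 / 24 * y ^+ 2)
    + x ^+ 4 * (- 1 / 72 * y ^+ 9 - 1 / 16 * y ^+ 8 - 1 / 12 * y ^+ 7
      + 7 / 120 * y ^+ 5 - 1 / 36 * y ^+ 3 + 1 / 240 * y).
rewrite (@sum_step _ (fun j => T m%:R j%:R)) => [||j].
- by rewrite /T; lra.
- by rewrite /T; lra.
- by rewrite /= -natr1 /T /inv12; lra.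
Qed.

Theorem theorem6 (n : nat) (hn : (1 < n)%N) :
  [/\ (\sum_(1 <= m < n) sigma' 1 11 m (n - m))%N%:R =
        (5223960%N%:R * n%:R ^+ 13 - 20638800%N%:R * n%:R) / 495331200%N%:R
          * psi (-1) n
        + n%:R ^+ 11 / 24 * psi 1 n
        - 691 * n%:R / 65520%N%:R * psi 11 n :> rat,
      (\sum_(1 <= m < n) sigma' 3 9 m (n - m))%N%:R =
        n%:R ^+ 13 / 2640 * psi (-1) n
        - n%:R ^+ 9 / 240 * psi 3 n
        + n%:R ^+ 3 / 264 * psi 9 n :> rat
    & (\sum_(1 <= m < n) sigma' 5 7 m (n - m))%N%:R =
        n%:R ^+ 13 / 10080%N%:R * psi (-1) n
        + n%:R ^+ 7 / 504 * psi 5 n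
        - n%:R ^+ 5 / 480 * psi 7 n :> rat].
Proof.
split.
- have odd_part u v : inv12 (- 1 / 12) (5 / 6) (- 47 / 24) u v
      - inv12 (- 1 / 12) (5 / 6) (- 47 / 24) u (u + v)
      = u ^+ 1 * v ^+ 11 + u ^+ 11 * v ^+ 1 by rewrite /inv12; lra.
  have row (m : nat) : \sum_(1 <= j < m.+1)
        inv12 (- 1 / 12) (5 / 6) (- 47 / 24) m%:R j%:R
      = (691 / 32760%N%:R) * m%:R ^+ 1 + (- 1 / 12) * m%:R ^+ 11
        + (- 691 / 32760%N%:R) * m%:R ^+ 13 by rewrite sum_inv12_1_11; lra.
  have := sum_sigma'_inv12 _ _ n _ _ _ _ _ _ hn odd_part row.
  have -> : 12 - 1%:Z = 11 by [].
  have -> : 12 - 11%:Z = 1 by [].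
  by lra.
- have odd_part u v : inv12 0 (- 1 / 10) (11 / 20) u v
      - inv12 0 (- 1 / 10) (11 / 20) u (u + v)
      = u ^+ 3 * v ^+ 9 + u ^+ 9 * v ^+ 3 by rewrite /inv12; lra.
  have row (m : nat) : \sum_(1 <= j < m.+1)
        inv12 0 (- 1 / 10) (11 / 20) m%:R j%:R
      = (- 1 / 132) * m%:R ^+ 3 + (1 / 120) * m%:R ^+ 9
        + (- 1 / 1320) * m%:R ^+ 13 by rewrite sum_inv12_3_9; lra.
  have := sum_sigma'_inv12 _ _ n _ _ _ _ _ _ hn odd_part row.
  have -> : 12 - 3%:Z = 9 by [].
  have -> : 12 - 9%:Z = 3 by [].
  by lra.
- have odd_part u v : inv12 0 0 (- 1 / 8) u v
      - inv12 0 0 (- 1 / 8) u (u + v)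
      = u ^+ 5 * v ^+ 7 + u ^+ 7 * v ^+ 5 by rewrite /inv12; lra.
  have row (m : nat) : \sum_(1 <= j < m.+1)
        inv12 0 0 (- 1 / 8) m%:R j%:R
      = (1 / 240) * m%:R ^+ 5 + (- 1 / 252) * m%:R ^+ 7
        + (- 1 / 5040%N%:R) * m%:R ^+ 13 by rewrite sum_inv12_5_7; lra.
  have := sum_sigma'_inv12 _ _ n _ _ _ _ _ _ hn odd_part row.
  have -> : 12 - 5%:Z = 7 by [].
  have -> : 12 - 7%:Z = 5 by [].
  by lra.
Qed.
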